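(* Let $\mathcal{F}\subseteq\mathcal{L}$ be a set of gambles (the favourable gambles) and let $\mathcal{S}\in\mathbb{M}$ be a favour-indifference background model with $0\in\mathcal{S}_{\mathrm{acc}}$. Then the assessment $\mathcal{M}=\langle\mathcal{S}_{\mathrm{ind}}\cup\mathcal{F};-\mathcal{F}\rangle$ is a favour-indifference model without confusion that dominates $\mathcal{S}$ (i.e., $\mathcal{M}\in\mathbb{M}$, $\mathcal{M}$ is a favour-indifference assessment, and $\mathcal{S}\subseteq\mathcal{M}$) if and only if all of the following hold: (F1) $\mathcal{S}_{\mathrm{fav}}\subseteq\mathcal{F}$; (F2) $0\notin\mathcal{F}$; (F3) $\mathcal{F}$ is a cone; (F4) $\mathcal{F}+\mathcal{S}_{\mathrm{ind}}\subseteq\mathcal{F}$.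
   Context: Let $\Omega$ be a non-empty set and let $\mathcal{L}$ be a real linear subspace of the vector space of all real-valued functions (''gambles'') on $\Omega$ with pointwise operations. For $\mathcal{K},\mathcal{K}'\subseteq\mathcal{L}$: $-\mathcal{K}=\{-f:f\in\mathcal{K}\}$; $\mathcal{K}+\mathcal{K}'=\{f+g:f\in\mathcal{K},g\in\mathcal{K}'\}$ (empty if either set is empty); $\mathcal{K}-\mathcal{K}'=\mathcal{K}+(-\mathcal{K}')$; $\overline{\mathcal{K}}=\{\lambda f:\lambda>0,f\in\mathcal{K}\}$; $\operatorname{posi}\mathcal{K}$ is the set of all linear combinations with strictly positive coefficients of non-empty finite families of elements of $\mathcal{K}$ (so $\operatorname{posi}\emptyset=\emptyset$). A cone is a set $\mathcal{K}\subseteq\mathcal{L}$ with $\operatorname{posi}\mathcal{K}=\mathcal{K}$. An assessment is a pair $\mathcal{A}=\langle\mathcal{A}_{\mathrm{acc}};\mathcal{A}_{\mathrm{rej}}\rangle$ of subsets of $\mathcal{L}$; inclusion is component-wise. Its favourable gambles are $\mathcal{A}_{\mathrm{fav}}=\mathcal{A}_{\mathrm{acc}}\cap-\mathcal{A}_{\mathrm{rej}}$ and its indifferent gambles are $\mathcal{A}_{\mathrm{ind}}=\mathcal{A}_{\mathrm{acc}}\cap-\mathcal{A}_{\mathrm{acc}}$. A favour-indifference assessment is one with $-\mathcal{A}_{\mathrm{rej}}\subseteq\mathcal{A}_{\mathrm{acc}}$ and $\mathcal{A}_{\mathrm{acc}}=\mathcal{A}_{\mathrm{fav}}\cup\mathcal{A}_{\mathrm{ind}}$.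 A model without confusion is an assessment $\mathcal{M}$ such that $\mathcal{M}_{\mathrm{acc}}\cap\mathcal{M}_{\mathrm{rej}}=\emptyset$, $\mathcal{M}_{\mathrm{acc}}$ is a cone, and $\overline{\mathcal{M}_{\mathrm{rej}}}\cup(\overline{\mathcal{M}_{\mathrm{rej}}}-\mathcal{M}_{\mathrm{acc}})\subseteq\mathcal{M}_{\mathrm{rej}}$. The set of these is $\mathbb{M}$. *)

(* Defs.v *)
From HB Require Import structures.
From mathcomp Require Import all_boot all_order all_algebra.
From mathcomp Require Import all_classical reals.

Set Implicit Arguments.
Unset Strict Implicit.
Unset Printing Implicit Defensive.

Import GRing.Theory Num.Theory.
Local Open Scope classical_set_scope.
Local Open Scope ring_scope.

(* The definitions make sense in any real vector space [V]; gambles on [Omega]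
   are the case [V := Omega -> R^o], where [R^o] is [R] as a module over itself.
   The ambient space of gambles is a set [L] of vectors. *)
Section Gambles.
Context {R : realType} {V : lmodType R}.
Implicit Types K L : set V.

Definition linear_subspace L : Prop := GRing.submod_closed [in L].

Definition oppset K : set V := [set - f | f in K].

Definition addset K K' : set V := [set f + g | f in K & g in K'].

Definition diffset K K' : set V := addset K (oppset K').

Definition scalings K : set V :=
  [set h | exists lambda f, [/\ 0 < lambda, K f & h = lambda *: f]].

(* Families are indexed by ['I_n.+1], hence non-empty. *)
Definition posi K : set V :=
  [set h | exists (n : nat) (c : 'I_n.+1 -> R) (f : 'I_n.+1 -> V),
     [/\ forall i, 0 < c i, forall i, K (f i) & h = \sum_i c i *: f i]].

Definition is_cone L K : Prop := K `<=` L /\ posi K = K.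

Record assessment := Assessment { acc : set V; rej : set V }.
Implicit Types A M : assessment.

Definition assessment_on L A : Prop := acc A `<=` L /\ rej A `<=` L.

Definition assessment_sub A A' : Prop :=
  acc A `<=` acc A' /\ rej A `<=` rej A'.

Definition fav A : set V := acc A `&` oppset (rej A).

Definition ind A : set V := acc A `&` oppset (acc A).

Definition favour_indifference A : Prop :=
  oppset (rej A) `<=` acc A /\ acc A = fav A `|` ind A.

Definition model_without_confusion L M : Prop :=
  [/\ assessment_on L M,
      acc M `&` rej M = set0,
      is_cone L (acc M)
    & scalings (rej M) `|` diffset (scalings (rej M)) (acc M)
        `<=` rej M].

End Gambles.

Arguments assessment {R} V.

(* Main.v *)
Require Import Defs.
From mathcomp Require Import all_boot all_order all_algebra.
From mathcomp Require Import all_classical reals.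

Set Implicit Arguments.
Unset Strict Implicit.
Unset Printing Implicit Defensive.

Import GRing.Theory Num.Theory.
Local Open Scope classical_set_scope.
Local Open Scope ring_scope.

(** A set is a cone exactly when it is closed under sums and under positive
    scalings ([is_coneP]), so every condition in play is a closure condition.
    Since the rejected set of [M] is [- F], the rejection axiom for [M] says
    that [F] is closed under positive scalings and under adding elements of
    [ind S `|` F] ([rej_oppsetP]); that is, [F] is a cone that absorbs [ind S].
    Granted this, and since [0] lies in [ind S], the accepted and rejected sets
    of [M] are disjoint exactly when [0] is not in [F]: a common element [h]
    has [- h] in [F] and [h] in [F] or in [ind S], and in both cases
    [- h + h = 0] lies in [F].  Since [ind S] is a cone, the accepted set of
    [M] is then a cone too ([model_without_confusion_oppset]).  It always
    splits into favourable and indifferent gambles, because [ind S] is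
    symmetric under negation ([favour_indifference_oppset]).  Finally, the
    accepted gambles of [S] are favourable or indifferent, and its rejected
    gambles are the opposites of its favourable ones; hence [M] dominates [S]
    exactly when [fav S `<=` F] ([assessment_sub_oppset]).  None of this uses
    that the vectors are functions. *)

Section Cones.
Context {R : realType} {V : lmodType R}.
Implicit Types (K L : set V) (h : V).

Lemma oppsetE K h : oppset K h <-> K (- h).
Proof.
split=> [[f Kf <-]|Kh]; first by rewrite opprK.
by exists (- h); rewrite ?opprK.
Qed.

(** Closure under binary sums; unlike in an additive submonoid, [0] need not
    belong to [K]. *)
Definition add_closed K := forall f g, K f -> K g -> K (f + g).

(** Closure under multiplication by strictly positive scalars. *)
Definition pos_scale_closed K := forall (l : R) f, 0 < l -> K f -> K (l *: f).

Lemma is_coneP L K :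
  is_cone L K <-> [/\ K `<=` L, add_closed K & pos_scale_closed K].
Proof.
split=> [[KL posiK]|[KL KD KZ]].
  split=> // [f g Kf Kg|l f l0 Kf]; rewrite -posiK.
    exists 1%N, (fun=> 1), (fun i => if i == ord0 then f else g).
    split=> // [i|]; first by case: ifP.
    by rewrite big_ord_recl big_ord1 /= !scale1r.
  by exists 0%N, (fun=> l), (fun=> f); split=> //; rewrite big_ord1.
split=> //; apply/seteqP; split=> h; last first.
  move=> Kh; exists 0%N, (fun=> 1), (fun=> h).
  by split=> //; rewrite big_ord1 scale1r.
move=> [n [c [f [c0 Kf ->]]]]; elim: n c f c0 Kf => [|n IHn] c f c0 Kf.
  by rewrite big_ord1; apply: KZ.
by rewrite big_ord_recl; apply: KD; [apply: KZ | apply: IHn].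
Qed.

Lemma linear_subspaceN L h : linear_subspace L -> L h -> L (- h).
Proof.
move=> [L0 LZD] Lh; rewrite -[- h]addr0 -scaleN1r.
by apply/set_mem/LZD => //; apply/mem_set.
Qed.

End Cones.

Section Models.
Context {R : realType} {V : lmodType R}.
Implicit Types (L F : set V) (S : assessment V).

(** For a rejected set of the form [- F], the rejection axiom is a closure
    property of [F]. *)
Lemma rej_oppsetP F A :
  scalings (oppset F) `|` diffset (scalings (oppset F)) A `<=` oppset F
  <-> pos_scale_closed F /\ (forall f a, F f -> A a -> F (f + a)).
Proof.
split=> [Frej|[FZ FD] h].
  have FZ : pos_scale_closed F.
    move=> l f l0 Ff; rewrite -[_ *: _]opprK -scalerN; apply/oppsetE/Frej.
    by left; exists l, (- f); split=> //; exists f.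
  split=> // f a Ff Aa; rewrite -[f + a]opprK opprD; apply/oppsetE/Frej.
  (* - f is itself a positive scaling of an element of - F, with factor 1 *)
  right; exists (- f); last by exists (- a) => //; exists a.
  by exists 1, (- f); rewrite scale1r; split=> //; exists f.
have scal_opp g : scalings (oppset F) g -> F (- g).
  by move=> [l [f [l0 /oppsetE Ff ->]]]; rewrite -scalerN; apply: FZ.
move=> [/scal_opp Fh|[g /scal_opp Fg [k /oppsetE Ak <-]]]; apply/oppsetE => //.
by rewrite opprD; apply: FD.
Qed.

Lemma ind_opp S h : ind S h -> ind S (- h).
Proof.
by move=> [Sh /oppsetE SNh]; split=> //; apply/oppsetE; rewrite opprK.
Qed.

Lemma ind_cone L S : is_cone L (acc S) -> is_cone L (ind S).
Proof.
move=> /is_coneP[SL SD SZ]; apply/is_coneP; split=> [h [/SL]//|f g|l f l0].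
  move=> [Sf /oppsetE SNf] [Sg /oppsetE SNg].
  by split; [exact: SD | apply/oppsetE; rewrite opprD; apply: SD].
move=> [Sf /oppsetE SNf].
by split; [exact: SZ | apply/oppsetE; rewrite -scalerN; apply: SZ].
Qed.

Lemma favour_indifference_oppset (I F : set V) :
  (forall h, I h -> I (- h)) ->
  favour_indifference (Assessment (I `|` F) (oppset F)).
Proof.
move=> IN; split=> [h /oppsetE/oppsetE|]; first by rewrite opprK; right.
apply/seteqP; split=> h; last by move=> [] [].
move=> [Ih|Fh]; [right|left]; split; rewrite /=; [by left| |by right|].
  by apply/oppsetE; left; apply: IN.
by apply/oppsetE/oppsetE; rewrite opprK.
Qed.

Lemma assessment_sub_oppset S F : favour_indifference S ->
  assessment_sub S (Assessment (ind S `|` F) (oppset F)) <-> fav S `<=` F.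
Proof.
move=> [rej_acc accE]; split=> [[_ rejS] f [_ /oppsetE/rejS]|favF].
  by move=> /oppsetE; rewrite opprK.
split=> h /=; first by rewrite accE => -[/favF|]; [right|left].
move=> rejh; have rejNh : oppset (rej S) (- h) by exists h.
by apply/oppsetE/favF; split=> //; apply: rej_acc.
Qed.

(** The accepted set is written [I `|` F] for an arbitrary symmetric cone [I]
    containing [0], which plays the role of the indifferent gambles. *)
Lemma model_without_confusion_oppset L (I F : set V) :
  linear_subspace L -> F `<=` L -> is_cone L I -> I 0 ->
  (forall h, I h -> I (- h)) ->
  model_without_confusion L (Assessment (I `|` F) (oppset F)) <->
  [/\ ~ F 0, is_cone L F & addset F I `<=` F].
Proof.
move=> Lsub FL /is_coneP[IL ID IZ] I0 IN.
split=> [[_ dis _ /rej_oppsetP[FZ FD]]|[F0 /is_coneP[_ FD FZ] FI]].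
  split=> [F0||_ [f Ff [i Ii <-]]]; last by apply: FD => //; left.
    (* if 0 were in F = - rej M, then 0 would be both accepted and rejected *)
    suff : set0 (0 : V) by [].
    by rewrite -dis; split; [left | apply/oppsetE; rewrite oppr0].
  by apply/is_coneP; split=> // f g Ff Fg; apply: FD => //; right.
have FDI f i : F f -> I i -> F (f + i).
  by move=> Ff Ii; apply/FI; exists f => //; exists i.
have FDacc f a : F f -> (I `|` F) a -> F (f + a).
  by move=> Ff [|]; [apply: FDI | apply: FD].
split.
- split=> h /=; first by move=> [/IL|/FL].
  by move=> /oppsetE/FL/(linear_subspaceN Lsub); rewrite opprK.
- apply/seteqP; split=> // h [acch /oppsetE Fh].
  by apply: F0; rewrite -(addNr h); apply: FDacc.
- apply/is_coneP; split=> [h [/IL|/FL]//|f g|l f l0].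
  + move=> [If|Ff] accg; last by right; apply: FDacc.
    case: accg => [Ig|Fg]; first by left; apply: ID.
    by right; rewrite addrC; apply: FDI.
  + by move=> [If|Ff]; [left; apply: IZ | right; apply: FZ].
- exact/rej_oppsetP.
Qed.

End Models.

Theorem theorem4p13 (R : realType) (Omega : Type)
    (Omega_neq0 : [set: Omega] !=set0)
    (L : set (Omega -> R^o)) (L_subspace : linear_subspace L)
    (F : set (Omega -> R^o)) (FL : F `<=` L)
    (S : assessment (Omega -> R^o))
    (S_model : model_without_confusion L S)
    (S_favind : favour_indifference S)
    (S_acc0 : acc S 0) :
  let M := Assessment (ind S `|` F) (oppset F) in
  [/\ model_without_confusion L M,
      favour_indifference M
    & assessment_sub S M]
  <->
  [/\ fav S `<=` F,
      ~ F 0,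
      is_cone L F
    & addset F (ind S) `<=` F].
Proof.
move=> M; have [_ _ Scone _] := S_model.
have I0 : ind S 0 by split=> //; apply/oppsetE; rewrite oppr0.
have modelP := model_without_confusion_oppset L_subspace FL
  (ind_cone Scone) I0 (@ind_opp _ _ S).
have subP := assessment_sub_oppset F S_favind.
split=> [[/modelP[F0 Fcone FI] _ /subP favF] //|[favF F0 Fcone FI]].
split; [exact/modelP | | exact/subP].
by apply: favour_indifference_oppset; apply: ind_opp.
Qed.
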